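(* Let $G$ be a finite digraph and $\mathbb{K}$ a commutative ring. Then there is an isomorphism of dg-algebras $$\Omega^\bullet(G)\cong\mathbb{K}G/T$$ sending $e^{x_0,\dots,x_n}+\mathcal{J}$ to $(x_0,\dots,x_n)+T$ for paths $(x_0,\dots,x_n)$, where $T$ is the ideal of $\mathbb{K}G$ generated by the quadratic relations $t_{x,y}$, indexed by pairs of vertices $x,y$ with $d(x,y)=2$ and defined by $$t_{x,y}=\sum_{v}(x,v,y),$$ the sum running over all vertices $v$ such that $(x,v,y)$ is a path. The differential on $\mathbb{K}G/T$ is defined on a path $p=(p_0,\dots,p_n)$ by $$\partial(p)=\sum_{i=0}^{n+1}\sum_{v}(-1)^i(p_0,\dots,p_{i-1},v,p_i,\dots,p_n),$$ where the second sum runs over all vertices $v$ such that $(p_0,\dots,p_{i-1},v,p_i,\dots,p_n)$ is a path in $G$.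
   Context: A digraph $G$ consists of a set of vertices $V(G)$ and a set of arrows, which are ordered pairs of distinct vertices. A path of length $n\ge 0$ is a tuple of vertices $(p_0,\dots,p_n)$ such that each $(p_i,p_{i+1})$ is an arrow; $d(x,y)$ is the infimum of lengths of paths from $x$ to $y$. The path algebra $\mathbb{K}G$ is the free $\mathbb{K}$-module on all paths (including those of length zero), with product given by concatenation (first path followed by second) when defined and zero otherwise, graded by length. The path cochain algebra $\Omega^\bullet(G)=\Omega^\bullet(G,\mathbb{K})$: set $X=V(G)$, $\Lambda^n(X)=\mathrm{Hom}_{\mathbb{K}}(\mathbb{K}\cdot X^{n+1},\mathbb{K})$, where $\mathbb{K}\cdot X^{n+1}$ is the free module on $(n+1)$-tuples, with dual basis $e^{x_0,\dots,x_n}$, and differential $$\partial(e^{x_0,\dots,x_n})=\sum_{i=0}^{n+1}\sum_{v\in X}(-1)^ie^{x_0,\dots,x_{i-1},v,x_i,\dots,x_n}.$$ $\mathcal{R}^\bullet\subseteq\Lambda^\bullet(X)$ is the subcomplex with $\mathcal{R}^n$ spanned by the $e^{x_0,\dots,x_n}$ with $x_i\neq x_{i+1}$ for all $i$. It is a dg-algebra with product $e^{x_0,\dots,x_n}e^{y_0,\dots,y_m}=e^{x_0,\dots,x_{n-1},y_0,\dots,y_m}$ if $y_0=x_n$, and $0$ otherwise. Let $\mathcal{N}^n\subseteq\mathcal{R}^n$ be the submodule spanned by the $e^{x_0,\dots,x_n}$ such that $(x_0,\dots,x_n)$ is not a path of $G$, and let $\mathcal{J}$ be the dg-ideal of $\mathcal{R}^\bullet$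 with $\mathcal{J}^n=\mathcal{N}^n+\partial(\mathcal{N}^{n-1})$. Then $\Omega^\bullet(G)=\mathcal{R}^\bullet/\mathcal{J}$. *)

(* Defs.v *)
From HB Require Import structures.
From mathcomp Require Import all_boot all_order all_algebra.
From mathcomp Require Import generic_quotient ring_quotient.
From mathcomp Require Import finmap.
From mathcomp Require Import boolp classical_sets.
From mathcomp Require Import monalg.

Set Implicit Arguments.
Unset Strict Implicit.
Unset Printing Implicit Defensive.

Import GRing.Theory.

Local Open Scope ring_scope.
Local Open Scope classical_set_scope.

(* MathComp's [algType] excludes the zero ring; here the ring of coefficients  *)
(* may be trivial and the digraph may be empty, so that zero algebras occur.   *)
HB.mixin Record isAssocAlgebra (K : comPzRingType) A of GRing.Lmodule K A := {
  amul : A -> A -> A;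
  aone : A;
  amulA : associative amul;
  amul1x : left_id aone amul;
  amulx1 : right_id aone amul;
  amulPl : forall (a : K) (x y z : A),
    amul (a *: x + y) z = a *: amul x z + amul y z;
  amulPr : forall (a : K) (x y z : A),
    amul z (a *: x + y) = a *: amul z x + amul z y
}.
#[short(type="assocAlgType")]
HB.structure Definition AssocAlgebra (K : comPzRingType) :=
  {A of GRing.Lmodule K A & isAssocAlgebra K A}.

Arguments aone {K} s.
Reserved Notation "x ** y" (at level 40, left associativity).
Notation "x ** y" := (amul x y) : ring_scope.

Section AssocAlgebraTheory.
Variables (K : comPzRingType) (A : assocAlgType K).
Implicit Types x y z : A.

Lemma amulDl : left_distributive (@amul K A) +%R.
Proof. by move=> x y z; rewrite -[x]scale1r amulPl !scale1r. Qed.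
Lemma amulDr : right_distributive (@amul K A) +%R.
Proof. by move=> z x y; rewrite -[x]scale1r amulPr !scale1r. Qed.
Lemma amul0x x : 0 ** x = 0.
Proof. by apply: (@addrI _ (0 ** x)); rewrite -amulDl !addr0. Qed.
Lemma amulx0 x : x ** 0 = 0.
Proof. by apply: (@addrI _ (x ** 0)); rewrite -amulDr !addr0. Qed.
Lemma amulZl a x y : (a *: x) ** y = a *: (x ** y).
Proof. by rewrite -[a *: x]addr0 amulPl amul0x addr0. Qed.
Lemma amulZr a x y : x ** (a *: y) = a *: (x ** y).
Proof. by rewrite -[a *: y]addr0 amulPr amulx0 addr0. Qed.
Lemma amulNl x y : (- x) ** y = - (x ** y).
Proof. by rewrite -scaleN1r amulZl scaleN1r. Qed.
Lemma amulNr x y : x ** (- y) = - (x ** y).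
Proof. by rewrite -scaleN1r amulZr scaleN1r. Qed.
Lemma amulBl x y z : (x - y) ** z = x ** z - y ** z.
Proof. by rewrite amulDl amulNl. Qed.
Lemma amulBr x y z : x ** (y - z) = x ** y - x ** z.
Proof. by rewrite amulDr amulNr. Qed.
Lemma amul_suml (J : Type) (r : seq J) (P : pred J) (g : J -> A) z :
  (\sum_(i <- r | P i) g i) ** z = \sum_(i <- r | P i) g i ** z.
Proof.
exact: (big_morph (amul^~ z) (fun x y => amulDl x y z) (amul0x z)).
Qed.
Lemma amul_sumr (J : Type) (r : seq J) (P : pred J) (g : J -> A) z :
  z ** (\sum_(i <- r | P i) g i) = \sum_(i <- r | P i) z ** g i.
Proof. exact: (big_morph (amul z) (amulDr z) (amulx0 z)). Qed.

End AssocAlgebraTheory.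

Section Submodules.
Variables (K : comPzRingType) (M : lmodType K).

Definition submodule (S : set M) : Prop :=
  S 0 /\ forall (a : K) u v, S u -> S v -> S (a *: u + v).

Definition span (B : set M) : set M := smallest submodule B.

Lemma span_submodule B : submodule (span B).
Proof.
split=> [|a u v Su Sv] S /= [HS BS]; first by case: HS.
by apply: HS.2; [apply: Su | apply: Sv].
Qed.

Lemma span_gen B b : B b -> span B b.
Proof. exact: sub_gen_smallest. Qed.

Lemma span_ind B (S : set M) : submodule S -> (forall b, B b -> S b) ->
  forall x, span B x -> S x.
Proof. by move=> HS BS x; apply: smallest_sub. Qed.

Lemma submod0 S : submodule S -> S 0. Proof. by case. Qed.

Lemma submodD S u v : submodule S -> S u -> S v -> S (u + v).
Proof. by move=> [_ SL] Su Sv; rewrite -[u]scale1r; apply: SL. Qed.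

Lemma submodZ S a u : submodule S -> S u -> S (a *: u).
Proof. by move=> [S0 SL] Su; rewrite -[_ *: _]addr0; apply: SL. Qed.

Lemma submodN S u : submodule S -> S u -> S (- u).
Proof. by move=> HS Su; rewrite -scaleN1r; apply: submodZ. Qed.

Lemma submodB S u v : submodule S -> S u -> S v -> S (u - v).
Proof. by move=> HS Su Sv; apply: submodD => //; apply: submodN. Qed.

Lemma submod_sum S (I : Type) (r : seq I) (P : pred I) (F : I -> M) :
  submodule S -> (forall i, P i -> S (F i)) -> S (\sum_(i <- r | P i) F i).
Proof.
move=> HS SF; apply: (big_ind S) => //; first exact: submod0.
by move=> u v; apply: submodD.
Qed.

End Submodules.

Section Ideals.
Variables (K : comPzRingType) (A : assocAlgType K).

Definition two_sided_ideal (I : set A) : Prop :=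
  submodule I /\ forall a x : A, I x -> I (a ** x) /\ I (x ** a).

Record ideal := Ideal {
  ideal_set :> A -> Prop;
  idealP : two_sided_ideal ideal_set
}.

Lemma ideal_gen_subproof (B : set A) :
  two_sided_ideal (smallest two_sided_ideal B).
Proof.
split; first split.
- by move=> S /= [HS _]; case: HS => -[].
- move=> a u v Su Sv S /= [HS BS].
  by apply: HS.1.2; [apply: Su | apply: Sv].
- by move=> a x Sx; split=> S /= [HS BS]; have Ix := Sx S (conj HS BS); case: (HS.2 a x Ix).
Qed.

Definition ideal_gen (B : set A) : ideal := Ideal (ideal_gen_subproof B).

End Ideals.

Section Quotient.
Variables (K : comPzRingType) (A : assocAlgType K) (I : ideal A).

Definition ideal_pred : {pred A} := fun x => `[< I x >].

Lemma ideal_predP x : reflect (I x) (x \in ideal_pred).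
Proof. exact: asboolP. Qed.

Lemma ideal_pred_closed : zmod_closed ideal_pred.
Proof.
have [HI _] := idealP I.
split=> [|x y]; first by apply/ideal_predP; apply: submod0.
by move=> /ideal_predP Ix /ideal_predP Iy; apply/ideal_predP; apply: submodB.
Qed.
HB.instance Definition _ := GRing.isZmodClosed.Build A ideal_pred
  ideal_pred_closed.

Definition quotient_alg : Type := (Quotient.quot ideal_pred).
HB.instance Definition _ := GRing.Zmodule.on quotient_alg.

Definition qproj (x : A) : quotient_alg := (\pi_((Quotient.quot ideal_pred)) x)%qT.
Definition qrepr (x : quotient_alg) : A := repr (x : (Quotient.quot ideal_pred)).

Lemma qreprK x : qproj (qrepr x) = x. Proof. exact: reprK. Qed.

Lemma qproj_eq x y : qproj x = qproj y <-> I (x - y).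
Proof.
split=> [/eqP|Ixy].
  by rewrite /qproj -[(_ == _)]Quotient.idealrBE => /ideal_predP.
by apply/eqP; rewrite /qproj -[(_ == _)]Quotient.idealrBE; apply/ideal_predP.
Qed.

Lemma qprojD x y : qproj (x + y) = qproj x + qproj y.
Proof. exact: raddfD. Qed.

Lemma qproj0 : qproj 0 = 0. Proof. exact: raddf0. Qed.

Lemma qprojK x : I (qrepr (qproj x) - x).
Proof. by apply/qproj_eq; rewrite qreprK. Qed.

Lemma qproj_eq0 x : qproj x = 0 <-> I x.
Proof. by rewrite -qproj0 qproj_eq subr0. Qed.

Definition qscale (a : K) (x : quotient_alg) : quotient_alg := qproj (a *: qrepr x).
Definition qmul (x y : quotient_alg) : quotient_alg := qproj (qrepr x ** qrepr y).

Lemma qproj_scale a x : qproj (a *: x) = qscale a (qproj x).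
Proof.
symmetry; apply/qproj_eq; rewrite -scalerBr.
by apply: submodZ (qprojK x); case: (idealP I).
Qed.

Lemma qproj_mul x y : qproj (x ** y) = qmul (qproj x) (qproj y).
Proof.
have [HI Im] := idealP I; symmetry; apply/qproj_eq.
rewrite -[_ - _](addrNK (x ** qrepr (qproj y))) [X in X + _]addrAC -amulBl.
rewrite -addrA [- _ + _]addrC -amulBr; apply: submodD => //.
  by apply: (Im _ _ _).2; apply: qprojK.
by apply: (Im _ _ _).1; apply: qprojK.
Qed.

Fact qscalerA a b x : qscale a (qscale b x) = qscale (a * b) x.
Proof. by rewrite -[x]qreprK -!qproj_scale scalerA. Qed.
Fact qscale1r : left_id 1 qscale.
Proof. by move=> x; rewrite -[x]qreprK -!qproj_scale scale1r. Qed.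
Fact qscalerDr : right_distributive qscale +%R.
Proof.
move=> a x y; rewrite -[x]qreprK -[y]qreprK -qprojD -!qproj_scale -qprojD.
by rewrite scalerDr.
Qed.
Fact qscalerDl x : {morph qscale^~ x : a b / a + b}.
Proof.
by move=> a b; rewrite -[x]qreprK -!qproj_scale -qprojD scalerDl.
Qed.
HB.instance Definition _ := GRing.Zmodule_isLmodule.Build K quotient_alg
  qscalerA qscale1r qscalerDr qscalerDl.

Lemma qprojZ a x : qproj (a *: x) = a *: qproj x.
Proof. exact: qproj_scale. Qed.

Fact qmulA : associative qmul.
Proof.
move=> x y z; rewrite -[x]qreprK -[y]qreprK -[z]qreprK -!qproj_mul.
by rewrite amulA.
Qed.
Fact qmul1x : left_id (qproj (aone A)) qmul.
Proof. by move=> x; rewrite -[x]qreprK -!qproj_mul amul1x. Qed.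
Fact qmulx1 : right_id (qproj (aone A)) qmul.
Proof. by move=> x; rewrite -[x]qreprK -!qproj_mul amulx1. Qed.
Fact qmulPl (a : K) x y z : qmul (a *: x + y) z = a *: qmul x z + qmul y z.
Proof.
rewrite -[x]qreprK -[y]qreprK -[z]qreprK -qprojZ -qprojD -!qproj_mul.
by rewrite -qprojZ -qprojD amulPl.
Qed.
Fact qmulPr (a : K) x y z : qmul z (a *: x + y) = a *: qmul z x + qmul z y.
Proof.
rewrite -[x]qreprK -[y]qreprK -[z]qreprK -qprojZ -qprojD -!qproj_mul.
by rewrite -qprojZ -qprojD amulPr.
Qed.
HB.instance Definition _ := isAssocAlgebra.Build K quotient_alg
  qmulA qmul1x qmulx1 qmulPl qmulPr.

Lemma qprojM x y : qproj (x ** y) = qproj x ** qproj y.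
Proof. exact: qproj_mul. Qed.
Lemma qproj1 : qproj (aone A) = aone quotient_alg. Proof. by []. Qed.

Lemma qproj_sum (J : Type) (r : seq J) (P : pred J) (F : J -> A) :
  qproj (\sum_(i <- r | P i) F i) = \sum_(i <- r | P i) qproj (F i).
Proof. exact: (big_morph qproj qprojD qproj0). Qed.

End Quotient.
Arguments qproj {K A} I x.

Section DGAlgebra.
Variable K : comPzRingType.

Record is_dg_algebra (A : assocAlgType K) (gr : nat -> set A) (d : A -> A) : Prop
  := IsDGAlgebra {
  dg_gr_submodule n : submodule (gr n);
  dg_gr_total x : exists n (c : nat -> A),
    (forall i, gr i (c i)) /\ x = \sum_(i < n) c i;
  dg_gr_direct n (c : nat -> A) : (forall i, gr i (c i)) ->
    \sum_(i < n) c i = 0 -> forall i, (i < n)%N -> c i = 0;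
  dg_gr1 : gr 0 (aone A);
  dg_grM m n x y : gr m x -> gr n y -> gr (m + n)%N (x ** y);
  dg_d_linear (a : K) x y : d (a *: x + y) = a *: d x + d y;
  dg_d_gr n x : gr n x -> gr n.+1 (d x);
  dg_dd x : d (d x) = 0;
  dg_leibniz n x y : gr n x -> d (x ** y) = d x ** y + (-1) ^+ n *: (x ** d y)
}.

Record dgAlgebra := DGAlgebra {
  dg_car :> assocAlgType K;
  dg_gr : nat -> set dg_car;
  dg_d : dg_car -> dg_car;
  dg_axioms : is_dg_algebra dg_gr dg_d
}.

Record dg_isomorphism (A B : dgAlgebra) (phi : A -> B) : Prop := {
  dgi_bij : bijective phi;
  dgi_linear (a : K) x y : phi (a *: x + y) = a *: phi x + phi y;
  dgi_one : phi (aone A) = aone B;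
  dgi_mul x y : phi (x ** y) = phi x ** phi y;
  dgi_gr n x : dg_gr n x -> dg_gr n (phi x);
  dgi_d x : phi (dg_d x) = dg_d (phi x)
}.

End DGAlgebra.

(* The module structure that monalg puts on {malg K[T]} requires K to be       *)
(* nontrivial, hence the alias.                                                *)
Definition freemod (K : comPzRingType) (T : choiceType) : Type := {malg K[T]}.

HB.lock Definition fscale (K : comPzRingType) (T : choiceType) (a : K)
    (x : freemod K T) : freemod K T :=
  \sum_(t <- msupp x) << a * x@_t *g t >>.
Canonical fscale_unlockable := Unlockable fscale.unlock.

Section FreeModule.
Variables (K : comPzRingType) (T : choiceType).
Local Notation F := (freemod K T).

HB.instance Definition _ := GRing.Zmodule.on F.

Definition fbasis (t : T) : F := << 1 *g t >>.
Local Notation fscale := (@fscale K T).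

Lemma fscaleE a x t : (fscale a x)@_t = a * x@_t.
Proof.
rewrite {2}[x]monalgE unlock !raddf_sum mulr_sumr.
by apply/eq_bigr=> /= i _; rewrite !mcoeffU mulrnAr.
Qed.

Fact fscalerA a b x : fscale a (fscale b x) = fscale (a * b) x.
Proof. by apply/malgP=> t; rewrite !fscaleE mulrA. Qed.
Fact fscale1r : left_id 1 fscale.
Proof. by move=> x; apply/malgP=> t; rewrite !fscaleE mul1r. Qed.
Fact fscalerDr : right_distributive fscale +%R.
Proof.
by move=> a x y; apply/malgP=> t; rewrite !(mcoeffD, fscaleE) mulrDr.
Qed.
Fact fscalerDl x : {morph fscale^~ x : a b / a + b}.
Proof.
by move=> a b; apply/malgP=> t; rewrite !(mcoeffD, fscaleE) mulrDl.
Qed.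
HB.instance Definition _ := GRing.Zmodule_isLmodule.Build K F
  fscalerA fscale1r fscalerDr fscalerDl.

Lemma fcoeffZ a (x : F) t : (a *: x)@_t = a * x@_t.
Proof. exact: fscaleE. Qed.

Lemma fbasisZ a t : a *: fbasis t = << a *g t >>.
Proof.
by apply/malgP => u; rewrite fcoeffZ !mcoeffU mulrnAr mulr1.
Qed.

Lemma freemodE (x : F) : x = \sum_(t <- msupp x) x@_t *: fbasis t.
Proof.
by rewrite {1}[x]monalgE; apply: eq_bigr => t _; rewrite fbasisZ.
Qed.

Lemma freemod_ind (S : set F) :
  submodule S -> (forall t, S (fbasis t)) -> forall x, S x.
Proof.
move=> HS Sb x; rewrite [x]freemodE; apply: submod_sum => // t _.
exact: submodZ.
Qed.

End FreeModule.

HB.lock Definition linext (K : comPzRingType) (T : choiceType) (M : lmodType K)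
    (f : T -> M) (x : freemod K T) : M :=
  \sum_(t <- msupp x) x@_t *: f t.
Canonical linext_unlockable := Unlockable linext.unlock.

Section LinearExtension.
Variables (K : comPzRingType) (T : choiceType) (M : lmodType K) (f : T -> M).
Local Notation F := (freemod K T).
Local Notation linext := (linext f).
Local Notation fbasis := (@fbasis K T).
Lemma linextw (D : {fset T}) (x : F) : (msupp x `<=` D)%fset ->
  linext x = \sum_(t <- D) x@_t *: f t.
Proof.
move=> le; rewrite unlock; apply: big_fset_incl => // t _ /mcoeff_outdom ->.
by rewrite scale0r.
Qed.

Lemma linext_linear a x y : linext (a *: x + y) = a *: linext x + linext y.
Proof.
pose D := (msupp x `|` msupp y `|` msupp (a *: x + y)%R)%fset.
have sub1 : (msupp x `<=` D)%fset.
  by apply/fsubsetP => t tx; rewrite !inE tx.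
have sub2 : (msupp y `<=` D)%fset.
  by apply/fsubsetP => t tx; rewrite !inE tx orbT.
have sub3 : (msupp (a *: x + y)%R `<=` D)%fset.
  by apply/fsubsetP => t tx; rewrite !inE tx orbT.
rewrite (linextw sub1) (linextw sub2) (linextw sub3) scaler_sumr -big_split /=.
by apply: eq_bigr => t _; rewrite mcoeffD fcoeffZ scalerDl scalerA.
Qed.

Lemma linext_basis t : linext (fbasis t) = f t.
Proof.
rewrite (@linextw [fset t]%fset); last exact: msuppU_le.
by rewrite big_seq_fset1 mcoeffUU scale1r.
Qed.

Lemma linext0 : linext 0 = 0.
Proof. by have:= linext_linear (-1) 0 0; rewrite scaler0 addr0 scaleN1r addNr. Qed.

Lemma linextZ a x : linext (a *: x) = a *: linext x.
Proof. by rewrite -[a *: x]addr0 linext_linear linext0 addr0. Qed.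

Lemma linextD x y : linext (x + y) = linext x + linext y.
Proof. by rewrite -[x]scale1r linext_linear !scale1r. Qed.

Lemma linext_sum (J : Type) (r : seq J) (P : pred J) (g : J -> F) :
  linext (\sum_(i <- r | P i) g i) = \sum_(i <- r | P i) linext (g i).
Proof. exact: (big_morph linext linextD linext0). Qed.

End LinearExtension.

(* A tuple (x_0, ..., x_n) with n >= 0 is encoded as (x_0, [:: x_1; ...; x_n]),*)
(* following the conventions of MathComp's path.                               *)
Notation vtuple V := (V * seq V)%type.

Section Tuples.
Variable V : eqType.
Implicit Types p q : vtuple V.

Definition tlast p : V := last p.1 p.2.

Definition tlength p : nat := size p.2.

Definition tpath (e : rel V) p : bool := path e p.1 p.2.

(* (p_0, ..., p_(i-1), v, p_i, ..., p_n), for i <= n + 1 *)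
Definition tinsert (i : nat) (v : V) p : vtuple V :=
  if i is j.+1 then (p.1, take j p.2 ++ v :: drop j p.2)
  else (v, p.1 :: p.2).

(* only meaningful when the last entry of p is the first entry of q *)
Definition tconcat p q : vtuple V := (p.1, p.2 ++ q.2).

Lemma tpath_cat e p q : tlast p = q.1 ->
  tpath e (tconcat p q) = tpath e p && tpath e q.
Proof. by rewrite /tlast /tpath /= cat_path => ->. Qed.

Lemma tlast_cat p q : tlast p = q.1 -> tlast (tconcat p q) = tlast q.
Proof. by rewrite /tlast /= last_cat => ->. Qed.

Lemma tlength_cat p q : tlength (tconcat p q) = (tlength p + tlength q)%N.
Proof. exact: size_cat. Qed.

Lemma tlength_insert i v p : (i <= (tlength p).+1)%N ->
  tlength (tinsert i v p) = (tlength p).+1.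
Proof.
case: i => [|j] //=; rewrite ltnS /tlength => lj /=.
by rewrite size_cat /= size_takel // size_drop addnS subnKC.
Qed.

End Tuples.

(* The free module on the tuples whose consecutive entries are related by e,   *)
(* with the bilinear product (x_0,...,x_n)(y_0,...,y_m) =                      *)
(* (x_0,...,x_(n-1),y_0,...,y_m) if x_n = y_0, and 0 otherwise. It is used for *)
(* e the arrow relation of G, where it is KG, and for e the full relation,     *)
(* where it is the direct sum of the Lambda^n(V), with basis the e^{x_0,...}.  *)
Section TupleAlgebra.
Variables (K : comPzRingType) (V : finType) (e : rel V).

Definition epath : choiceType := {p : vtuple V | tpath e p}.

Definition tuple_algebra : Type := freemod K epath.
HB.instance Definition _ := GRing.Lmodule.on tuple_algebra.
Local Notation A := tuple_algebra.

Definition tbasis (p : vtuple V) : A :=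
  if insub p is Some p' then fbasis K (p' : epath) else 0.

Definition tbasis_mul (p q : vtuple V) : A :=
  if tlast p == q.1 then tbasis (tconcat p q) else 0.

End TupleAlgebra.

HB.lock Definition tmul (K : comPzRingType) (V : finType) (e : rel V)
    (x y : tuple_algebra K e) : tuple_algebra K e :=
  linext (fun p : epath e =>
    linext (fun q : epath e => tbasis_mul K e (val p) (val q)) y) x.
Canonical tmul_unlockable := Unlockable tmul.unlock.

HB.lock Definition tone (K : comPzRingType) (V : finType) (e : rel V) :
    tuple_algebra K e :=
  \sum_(v : V) tbasis K e (v, [::]).
Canonical tone_unlockable := Unlockable tone.unlock.

Section TupleAlgebraTheory.
Variables (K : comPzRingType) (V : finType) (e : rel V).
Local Notation A := (tuple_algebra K e).
Local Notation epath := (epath e).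
Local Notation tbasis := (tbasis K e).
Local Notation tbasis_mul := (tbasis_mul K e).
Local Notation tmul := (@tmul K V e).
Local Notation tone := (tone K e).

Lemma tbasis_val (p : epath) : tbasis (val p) = fbasis K p.
Proof. by rewrite /tbasis valK. Qed.

Lemma tbasis_out p : ~~ tpath e p -> tbasis p = 0.
Proof. by move=> np; rewrite /tbasis insubN. Qed.

Lemma tuple_algebra_ind (S : set A) : submodule S ->
  (forall p, tpath e p -> S (tbasis p)) -> forall x, S x.
Proof.
move=> HS Sb; apply: freemod_ind => // p; rewrite -tbasis_val.
by apply: Sb; exact: valP.
Qed.

Lemma tmul_linearl a x y z : tmul (a *: x + y) z = a *: tmul x z + tmul y z.
Proof. rewrite tmul.unlock; exact: linext_linear. Qed.

Lemma tmul_linearr a x y z : tmul z (a *: x + y) = a *: tmul z x + tmul z y.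
Proof.
have E y' : tmul z y' = \sum_(p <- msupp z)
    z@_p *: linext (fun q : epath => tbasis_mul (val p) (val q)) y'.
  by rewrite tmul.unlock [LHS](congr1 (fun f => f _ _ _ _ _) linext.unlock).
rewrite !E scaler_sumr -big_split /=; apply: eq_bigr => p _.
by rewrite linext_linear scalerDr !scalerA mulrC.
Qed.

Lemma tmul0l z : tmul 0 z = 0. Proof. rewrite tmul.unlock; exact: linext0. Qed.
Lemma tmulDl : left_distributive tmul +%R.
Proof. by move=> x y z; rewrite -[x]scale1r tmul_linearl !scale1r. Qed.
Lemma tmulDr : right_distributive tmul +%R.
Proof. by move=> z x y; rewrite -[x]scale1r tmul_linearr !scale1r. Qed.
Lemma tmul0r z : tmul z 0 = 0.
Proof. by apply: (@addrI _ (tmul z 0)); rewrite -tmulDr !addr0. Qed.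
Lemma tmul_basis p q : tpath e p -> tpath e q ->
  tmul (tbasis p) (tbasis q) = tbasis_mul p q.
Proof.
move=> pp pq; rewrite -[p](SubK (epath : subType _) pp).
by rewrite -[q](SubK (epath : subType _) pq) !tbasis_val tmul.unlock !linext_basis.
Qed.

Lemma tmul_suml (J : Type) (r : seq J) (P : pred J) (g : J -> A) z :
  tmul (\sum_(i <- r | P i) g i) z = \sum_(i <- r | P i) tmul (g i) z.
Proof.
exact: (big_morph (tmul^~ z) (fun x y => tmulDl x y z) (tmul0l z)).
Qed.

Lemma tmul_sumr (J : Type) (r : seq J) (P : pred J) (g : J -> A) z :
  tmul z (\sum_(i <- r | P i) g i) = \sum_(i <- r | P i) tmul z (g i).
Proof. exact: (big_morph (tmul z) (tmulDr z) (tmul0r z)). Qed.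

Fact tmulA : associative tmul.
Proof.
move=> x y z; move: x; apply: tuple_algebra_ind.
  split=> [|a u v /= Hu Hv]; first by rewrite !tmul0l.
  by rewrite !tmul_linearl Hu Hv.
move=> p pp; move: y; apply: tuple_algebra_ind.
  split=> [|a u v /= Hu Hv]; first by rewrite tmul0l !tmul0r tmul0l.
  by rewrite tmul_linearl !tmul_linearr tmul_linearl Hu Hv.
move=> q pq; move: z; apply: tuple_algebra_ind.
  split=> [|a u v /= Hu Hv]; first by rewrite !tmul0r.
  by rewrite !tmul_linearr Hu Hv.
move=> r pr; rewrite !tmul_basis // /tbasis_mul.
case: eqP => [qr|nqr]; case: eqP => [pq'|npq].
- rewrite !tmul_basis ?tpath_cat ?pp ?pq //.
  by rewrite /tbasis_mul tlast_cat //= qr pq' !eqxx /tconcat /= catA.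
- rewrite tmul0l tmul_basis ?tpath_cat ?pq // /tbasis_mul /=.
  by case: eqP.
- rewrite tmul0r tmul_basis ?tpath_cat ?pp // /tbasis_mul tlast_cat //.
  by case: eqP.
- by rewrite tmul0l tmul0r.
Qed.

Fact tmul1l : left_id tone tmul.
Proof.
apply: tuple_algebra_ind.
  split=> [|a u v /= Hu Hv]; first by rewrite tmul0r.
  by rewrite tmul_linearr Hu Hv.
move=> p pp; rewrite tone.unlock tmul_suml (bigD1 p.1) //= big1 ?addr0 => [|v vp].
  by rewrite tmul_basis // /tbasis_mul eqxx /tconcat /=; case: (p).
by rewrite tmul_basis // /tbasis_mul /tlast /= (negbTE vp).
Qed.

Fact tmul1r : right_id tone tmul.
Proof.
apply: tuple_algebra_ind.
  split=> [|a u v /= Hu Hv]; first by rewrite tmul0l.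
  by rewrite tmul_linearl Hu Hv.
move=> p pp; rewrite tone.unlock tmul_sumr (bigD1 (tlast p)) //= big1 ?addr0 => [|v vp].
  by rewrite tmul_basis // /tbasis_mul eqxx /tconcat /= cats0; case: (p).
by rewrite tmul_basis // /tbasis_mul eq_sym (negbTE vp).
Qed.

HB.instance Definition _ := isAssocAlgebra.Build K A
  tmulA tmul1l tmul1r tmul_linearl tmul_linearr.

Lemma tbasisM p q : tpath e p -> tpath e q ->
  tbasis p ** tbasis q = if tlast p == q.1 then tbasis (tconcat p q) else 0.
Proof. exact: tmul_basis. Qed.

Lemma tuple_algebra_oneE :
  aone (tuple_algebra K e) = \sum_(v : V) tbasis (v, [::]).
Proof. by rewrite -[LHS]/tone tone.unlock. Qed.

End TupleAlgebraTheory.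

Definition full_rel (V : Type) : rel V := fun _ _ => true.
Arguments full_rel V : clear implicits.

(* The direct sum of the Lambda^n(V): as V is finite, the dual basis elements  *)
(* e^{x_0,...,x_n} form a basis of Lambda^n(V) = Hom(K V^(n+1), K).            *)
Notation Lambda K V := (tuple_algebra K (full_rel V)).

Section Lambda.
Variables (K : comPzRingType) (V : finType).
Implicit Types p q : vtuple V.

Definition lam_e (x : vtuple V) : Lambda K V := tbasis K (full_rel V) x.

Definition lam_d : Lambda K V -> Lambda K V :=
  linext (fun x : epath (full_rel V) =>
    \sum_(i < (tlength (val x)).+2) \sum_(v : V)
      (-1) ^+ i *: lam_e (tinsert i v (val x))).

Lemma tpath_full (x : vtuple V) : tpath (full_rel V) x.
Proof. by case: x => x s; rewrite /tpath /=; elim: s x => //=. Qed.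

Lemma lam_ind (S : set (Lambda K V)) : submodule S ->
  (forall p, S (lam_e p)) -> forall x, S x.
Proof. by move=> HS He; apply: tuple_algebra_ind => // p _; apply: He. Qed.

Lemma lam_eM p q :
  lam_e p ** lam_e q = if tlast p == q.1 then lam_e (tconcat p q) else 0.
Proof. by apply: tbasisM; exact: tpath_full. Qed.

Lemma lam_d_e (x : vtuple V) : lam_d (lam_e x) =
  \sum_(i < (tlength x).+2) \sum_(v : V) (-1) ^+ i *: lam_e (tinsert i v x).
Proof.
rewrite /lam_e; have xf := tpath_full x.
rewrite -[in LHS](SubK (epath (full_rel V) : subType _) xf) tbasis_val.
by rewrite /lam_d linext_basis !SubK.
Qed.

Lemma lam_d_linear (a : K) x y : lam_d (a *: x + y) = a *: lam_d x + lam_d y.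
Proof. exact: linext_linear. Qed.
Lemma lam_d0 : lam_d 0 = 0. Proof. exact: linext0. Qed.
Lemma lam_dD x y : lam_d (x + y) = lam_d x + lam_d y.
Proof. exact: linextD. Qed.
Lemma lam_dZ (a : K) x : lam_d (a *: x) = a *: lam_d x.
Proof. exact: linextZ. Qed.
Lemma lam_d_sum (J : Type) (r : seq J) (P : pred J) (g : J -> Lambda K V) :
  lam_d (\sum_(i <- r | P i) g i) = \sum_(i <- r | P i) lam_d (g i).
Proof. exact: linext_sum. Qed.

Lemma tinsert_swap (i j : nat) (v w : V) (x : vtuple V) : (i <= (tlength x).+1)%N ->
  (j <= i)%N -> tinsert j w (tinsert i v x) = tinsert i.+1 v (tinsert j w x).
Proof.
case: x => x s; rewrite /tlength /=.
case: j => [|j]; case: i => [|i] //=; rewrite !ltnS => li ji.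
have lj : (j <= size s)%N := leq_trans ji li.
congr (_, _); rewrite !take_cat !drop_cat !size_takel //.
have [->|ltji] := eqVneq j i.
  have nii : (i.+1 < i)%N = false by rewrite ltnNge leqnSn.
  by rewrite !ltnn subnn nii subSnn /= take0 drop0 cats0 -catA.
have ji' : (j < i)%N by rewrite ltn_neqAle ltji.
have nij : (i.+1 < j)%N = false by rewrite ltnNge (leq_trans ji (leqnSn i)).
rewrite ji' nij subSn //= take_takel // -catA /=.
congr (_ ++ _ :: _).
by rewrite take_drop drop_drop subnK.
Qed.

Lemma sum_alt_cancel (M : lmodType K) (N : nat) (F : nat -> nat -> M) :
  (forall i j, (i < N)%N -> (j <= i)%N -> F i j = F j i.+1) ->
  \sum_(i < N) \sum_(j < N.+1) (-1) ^+ (i + j) *: F i j = 0.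
Proof.
move=> FE.
transitivity (\sum_(i < N) \sum_(j < N | (j <= i)%N) (-1) ^+ (i + j) *: F i j
  + \sum_(i < N) \sum_(j < N | (i <= j)%N) (-1) ^+ (i + j).+1 *: F i j.+1).
  rewrite -big_split /=; apply: eq_bigr => i _.
  rewrite (bigID (fun j : 'I_N.+1 => (j <= i)%N)) /=; congr (_ + _).
    rewrite big_mkcond big_ord_recr /= leqNgt ltn_ord /= addr0.
    by rewrite -big_mkcond.
  rewrite big_mkcond big_ord_recl /= add0r -big_mkcond /=.
  apply: eq_big => [j|j _]; first by rewrite -ltnNge /bump /= add1n ltnS.
  by rewrite /bump /= add1n addnS.
rewrite [X in _ + X](exchange_big_dep xpredT) //= -big_split big1 //= => i _.
rewrite -big_split big1 //= => j ji.
by rewrite exprS mulN1r scaleNr [(j + i)%N]addnC (FE i j) // addrN.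
Qed.

Lemma lam_dd x : lam_d (lam_d x) = 0.
Proof.
move: x; apply: lam_ind => [|p].
  split=> [|a u v /= Hu Hv]; first by rewrite !lam_d0.
  by rewrite !lam_d_linear Hu Hv scaler0 addr0.
rewrite lam_d_e lam_d_sum.
pose F i j := \sum_(v : V) \sum_(w : V) lam_e (tinsert j w (tinsert i v p)).
rewrite -[RHS](@sum_alt_cancel _ (tlength p).+2 F); last first.
  move=> i j li ji; rewrite /F exchange_big; apply: eq_bigr => w _.
  by apply: eq_bigr => v _; rewrite tinsert_swap.
apply: eq_bigr => i _; rewrite lam_d_sum.
transitivity (\sum_(v : V) \sum_(j < (tlength p).+3)
   \sum_(w : V) (-1) ^+ (i + j) *: lam_e (tinsert j w (tinsert i v p))).
  apply: eq_bigr => v _; rewrite lam_dZ lam_d_e tlength_insert; last first.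
    by rewrite -ltnS.
  rewrite scaler_sumr; apply: eq_bigr => j _.
  by rewrite scaler_sumr; apply: eq_bigr => w _; rewrite scalerA -exprD.
rewrite exchange_big; apply: eq_bigr => j _; rewrite scaler_sumr.
by apply: eq_bigr => v _; rewrite scaler_sumr.
Qed.

Lemma tlast_insert i v p : (i <= tlength p)%N -> tlast (tinsert i v p) = tlast p.
Proof.
case: p => x s; case: i => [|i] //=; rewrite /tlength /tlast /= => li.
rewrite last_cat /= -[in RHS](cat_take_drop i s) last_cat.
by rewrite (drop_nth x li).
Qed.

Lemma tinsert_catl i v p q : (i <= tlength p)%N ->
  tinsert i v (tconcat p q) = tconcat (tinsert i v p) q.
Proof.
case: p => x s; case: i => [|i] //=; rewrite /tlength /tconcat /= => li.
by rewrite takel_cat ?(ltnW li) // drop_cat li -catA.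
Qed.

Lemma tinsert_catr k v p q :
  tinsert ((tlength p).+1 + k) v (tconcat p q) = tconcat p (tinsert k.+1 v q).
Proof.
case: p => x s; rewrite /tlength /tconcat addSn /=.
rewrite take_cat drop_cat ltnNge leq_addr /= addKn; congr (_, _).
by rewrite -catA.
Qed.

Lemma lam_leibniz_e p y :
  lam_d (lam_e p ** y) = lam_d (lam_e p) ** y
    + (-1) ^+ (tlength p) *: (lam_e p ** lam_d y).
Proof.
move: y; apply: lam_ind => [|q].
  split=> [|a u v /= Hu Hv]; first by rewrite lam_d0 !amulx0 lam_d0 scaler0 addr0.
  rewrite lam_d_linear !amulPr lam_d_linear Hu Hv !scalerDr !scalerA.
  by rewrite [(_ ^+ _) * a]mulrC addrACA.
set n := tlength p; set m := tlength q.
pose Z := lam_e (p.1, p.2 ++ q.1 :: q.2).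
have EL : lam_d (lam_e p) ** lam_e q =
    \sum_(i < n.+1) \sum_v (-1) ^+ i *: (lam_e (tinsert i v p) ** lam_e q)
    + (-1) ^+ n.+1 *: Z.
  rewrite lam_d_e big_ord_recr amulDl !amul_suml; congr (_ + _).
    apply: eq_bigr => i _; rewrite amul_suml.
    by apply: eq_bigr => v _; rewrite amulZl.
  rewrite (bigD1 q.1) //= big1 ?addr0 => [|v vq].
    rewrite amulZl lam_eM /tlast /n /tlength take_size drop_size last_cat eqxx.
    by rewrite /tconcat /= -catA.
  rewrite amulZl lam_eM /tlast /n /tlength take_size drop_size last_cat /=.
  by rewrite (negbTE vq) scaler0.
have ER : lam_e p ** lam_d (lam_e q) = Z +
    \sum_(k < m.+1) \sum_v (-1) ^+ k.+1 *: (lam_e p ** lam_e (tinsert k.+1 v q)).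
  rewrite lam_d_e big_ord_recl amulDr !amul_sumr; congr (_ + _).
    rewrite (bigD1 (tlast p)) //= big1 ?addr0 => [|v vq].
      by rewrite expr0 scale1r lam_eM eqxx.
    by rewrite expr0 scale1r lam_eM eq_sym (negbTE vq).
  apply: eq_bigr => i _; rewrite amul_sumr.
  by apply: eq_bigr => v _; rewrite amulZr.
rewrite EL ER scalerDr addrA exprS mulN1r scaleNr addrNK.
rewrite lam_eM; case: eqP => [pq|/eqP/negbTE pq]; last first.
  rewrite lam_d0 !big1 ?scaler0 ?addr0 // => i _; apply: big1 => v _.
    by rewrite lam_eM pq scaler0.
  by rewrite lam_eM tlast_insert ?pq ?scaler0 // -ltnS.
rewrite lam_d_e tlength_cat -/n -/m.
have -> : (n + m).+2 = (n.+1 + m.+1)%N by rewrite addnS.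
rewrite big_split_ord; congr (_ + _).
  apply: eq_bigr => i _; apply: eq_bigr => v _; have li : (i <= n)%N by rewrite -ltnS.
  by rewrite lam_eM tlast_insert // pq eqxx tinsert_catl.
rewrite scaler_sumr; apply: eq_bigr => k _; rewrite scaler_sumr.
apply: eq_bigr => v _; rewrite [tinsert _ _ _]tinsert_catr lam_eM.
by rewrite [(tinsert _ _ _).1]/(q.1) pq eqxx scalerA -exprD [RHS]/((-1) ^+ (n + k.+1) *: _) -[(n + k.+1)%N]addSnnS.
Qed.

Definition regular (x : vtuple V) : bool := tpath (fun a b => a != b) x.

Definition reg_span : set (Lambda K V) :=
  span [set z | exists2 x, regular x & z = lam_e x].

Lemma reg_span_e (x : vtuple V) : regular x -> reg_span (lam_e x).
Proof. by move=> rx; apply: span_gen; exists x. Qed.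

Lemma reg_span_mul x y : reg_span x -> reg_span y -> reg_span (x ** y).
Proof.
have HR : submodule reg_span by apply: span_submodule.
move=> Rx Ry; move: x Rx; apply: span_ind => [|_ [p rp ->]].
  split=> [|a u v /= Hu Hv]; first by rewrite amul0x; apply: submod0.
  by rewrite amulPl; apply: HR.2.
move: y Ry; apply: span_ind => [|_ [q rq ->]].
  split=> [|a u v /= Hu Hv]; first by rewrite amulx0; apply: submod0.
  by rewrite amulPr; apply: HR.2.
rewrite lam_eM; case: eqP => [pq|_]; last exact: submod0.
by apply: reg_span_e; rewrite /regular tpath_cat //; apply/andP.
Qed.

Lemma reg_span_one : reg_span (aone (Lambda K V)).
Proof.
rewrite tuple_algebra_oneE.
apply: submod_sum => [|v _]; first exact: span_submodule.
exact: reg_span_e.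
Qed.

Lemma reg_span_d_e p : regular p -> reg_span (lam_d (lam_e p)).
Proof.
have HR : submodule reg_span by apply: span_submodule.
have d1 x y : x != y -> reg_span (lam_d (lam_e (x, [:: y]))).
  move=> xy; have yx : y != x by rewrite eq_sym.
  rewrite lam_d_e /= !big_ord_recl big_ord0 /= addr0 -!big_split /=.
  rewrite (bigD1 x) // (bigD1 y) //= addrA.
  apply: (submodD HR); last first.
    apply: (submod_sum _ HR) => v /andP[vx vy].
    rewrite expr0 scale1r /bump /= expr1 scaleN1r sqrrN expr1n scale1r.
    have xv : x != v by rewrite eq_sym.
    have yv : y != v by rewrite eq_sym.
    apply: (submodD HR);
      last (apply: (submodD HR); first apply: (submodN HR));
      apply: reg_span_e; by rewrite /regular /tpath /= ?xy ?vx ?vy ?xv ?yv.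
  rewrite expr0 !scale1r /bump /= expr1 !scaleN1r sqrrN expr1n !scale1r.
  rewrite addNKr addNr addr0.
  by apply: (submodD HR); apply: reg_span_e; rewrite /regular /tpath /= ?xy ?yx.
case: p => x s; elim: s x => [|y s IH] x.
  move=> _; rewrite lam_d_e /= big_ord_recl big_ord1 /= -big_split /=.
  apply: (submod_sum _ HR) => v _; rewrite expr0 scale1r expr1 scaleN1r.
  have [->|vx] := eqVneq v x; first by rewrite subrr; exact: (submod0 HR).
  have xv : x != v by rewrite eq_sym.
  by apply: (submodB HR); apply: reg_span_e; rewrite /regular /tpath /= ?vx ?xv.
move=> rp; have xy : x != y by case/andP: rp.
have rys : regular (y, s) by case/andP: rp.
have -> : lam_e (x, y :: s) = lam_e (x, [:: y]) ** lam_e (y, s).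
  by rewrite lam_eM eqxx.
rewrite lam_leibniz_e; apply: (submodD HR).
  by apply: reg_span_mul; [exact: d1 | exact: reg_span_e].
apply: (submodZ _ HR); apply: reg_span_mul; last exact: IH.
by apply: reg_span_e; rewrite /regular /tpath /= xy.
Qed.

End Lambda.

Section RegularComplex.
Variables (K : comPzRingType) (V : finType).

Definition reg_pred : {pred Lambda K V} := fun x => `[< @reg_span K V x >].

Lemma reg_predP x : reflect (@reg_span K V x) (x \in reg_pred).
Proof. exact: asboolP. Qed.

Fact reg_pred_submod_closed : GRing.submod_closed reg_pred.
Proof.
have HR : submodule (@reg_span K V) by apply: span_submodule.
split=> [|a u v /reg_predP Ru /reg_predP Rv]; apply/reg_predP.
  exact: (submod0 HR).
exact: HR.2.
Qed.
HB.instance Definition _ := GRing.isSubmodClosed.Build K (Lambda K V) reg_pred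
  reg_pred_submod_closed.

Record reg_complex : Type := RegComplex {
  reg_val : Lambda K V;
  reg_valP : reg_val \in reg_pred
}.
HB.instance Definition _ := [isSub for reg_val].
HB.instance Definition _ := [Choice of reg_complex by <:].
HB.instance Definition _ := [SubChoice_isSubLmodule of reg_complex by <:].
Local Notation R := reg_complex.

Lemma reg_inR (x : R) : reg_span (val x).
Proof. by apply/reg_predP; exact: reg_valP. Qed.

Fact reg_mul_subproof (x y : R) : val x ** val y \in reg_pred.
Proof. by apply/reg_predP; apply: reg_span_mul; apply: reg_inR. Qed.
Fact reg_one_subproof : aone (Lambda K V) \in reg_pred.
Proof. by apply/reg_predP; apply: reg_span_one. Qed.
Fact reg_d_subproof (x : R) : lam_d (val x) \in reg_pred.
Proof.
apply/reg_predP; move: (val x) (reg_inR x).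
have HR : submodule (@reg_span K V) by apply: span_submodule.
apply: span_ind => [|_ [p rp ->]]; last exact: reg_span_d_e.
split=> [|a u v /= Hu Hv]; first by rewrite lam_d0; apply: (submod0 HR).
by rewrite lam_d_linear; apply: HR.2.
Qed.

Definition reg_mul (x y : R) : R := RegComplex (reg_mul_subproof x y).
Definition reg_one : R := RegComplex reg_one_subproof.
Definition reg_d (x : R) : R := RegComplex (reg_d_subproof x).

Lemma val_regP (a : K) (x y : R) : val (a *: x + y) = a *: val x + val y.
Proof. by []. Qed.

Fact reg_mulA : associative reg_mul.
Proof. by move=> x y z; apply: val_inj; exact: amulA. Qed.
Fact reg_mul1x : left_id reg_one reg_mul.
Proof. by move=> x; apply: val_inj; exact: amul1x. Qed.
Fact reg_mulx1 : right_id reg_one reg_mul.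
Proof. by move=> x; apply: val_inj; exact: amulx1. Qed.
Fact reg_mulPl (a : K) x y z :
  reg_mul (a *: x + y) z = a *: reg_mul x z + reg_mul y z.
Proof. by apply: val_inj; exact: amulPl. Qed.
Fact reg_mulPr (a : K) x y z :
  reg_mul z (a *: x + y) = a *: reg_mul z x + reg_mul z y.
Proof. by apply: val_inj; exact: amulPr. Qed.
HB.instance Definition _ := isAssocAlgebra.Build K R
  reg_mulA reg_mul1x reg_mulx1 reg_mulPl reg_mulPr.

Lemma val_reg0 : val (0 : R) = 0.
Proof. by []. Qed.
Lemma val_regM (x y : R) : val (x ** y) = val x ** val y.
Proof. by []. Qed.
Lemma val_reg_d (x : R) : val (reg_d x) = lam_d (val x).
Proof. by []. Qed.

(* e^x as an element of R, for a regular tuple x (and 0 otherwise) *)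
Definition reg_e (x : vtuple V) : R := insubd 0 (lam_e K x).

Lemma val_reg_e x : regular x -> val (reg_e x) = lam_e K x.
Proof.
move=> rx; rewrite /reg_e insubdK //; apply/reg_predP; exact: reg_span_e.
Qed.

Lemma reg_d_linear (a : K) x y : reg_d (a *: x + y) = a *: reg_d x + reg_d y.
Proof. by apply: val_inj; exact: lam_d_linear. Qed.
Lemma reg_d0 : reg_d 0 = 0.
Proof. by apply: val_inj; exact: lam_d0. Qed.
Lemma reg_dD x y : reg_d (x + y) = reg_d x + reg_d y.
Proof. by apply: val_inj; exact: lam_dD. Qed.
Lemma reg_dd x : reg_d (reg_d x) = 0.
Proof. by apply: val_inj; exact: lam_dd. Qed.

Lemma reg_ind (S : set R) : submodule S ->
  (forall p, regular p -> S (reg_e p)) -> forall x, S x.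
Proof.
move=> HS Se x.
suff H : forall z, reg_span z -> exists2 w : R, S w & val w = z.
  by have [w Sw /val_inj <-] := H _ (reg_inR x).
apply: span_ind => [|_ [p rp ->]].
  split=> [|a u v /= [u' Su <-] [v' Sv <-]].
    by exists 0 => //; apply: (submod0 HS).
  by exists (a *: u' + v') => //; apply: HS.2.
by exists (reg_e p); [apply: Se | rewrite val_reg_e].
Qed.

Lemma reg_eM p q : regular p -> regular q -> reg_e p ** reg_e q =
  if tlast p == q.1 then reg_e (tconcat p q) else 0.
Proof.
move=> rp rq; apply: val_inj.
rewrite val_regM !val_reg_e // lam_eM; case: eqP => [pq|_] //.
by rewrite val_reg_e // /regular tpath_cat //; apply/andP.
Qed.

Lemma reg_leibniz_e p y : regular p ->
  reg_d (reg_e p ** y) = reg_d (reg_e p) ** y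
    + (-1) ^+ (tlength p) *: (reg_e p ** reg_d y).
Proof.
move=> rp; apply: val_inj.
rewrite val_reg_d val_regM addrC val_regP !val_regM !val_reg_d val_reg_e //.
by rewrite lam_leibniz_e addrC.
Qed.

Definition reg_gr (n : nat) : set R :=
  span [set z | exists2 x, regular x && (tlength x == n) & z = reg_e x].

End RegularComplex.

Record digraph (V : finType) := Digraph {
  arrow :> rel V;
  arrow_irr : irreflexive arrow
}.

Section PathCochainAlgebra.
Variables (K : comPzRingType) (V : finType) (G : digraph V).
Local Notation R := (reg_complex K V).

Definition nonpath_span : set R :=
  span [set z | exists2 x, regular x && ~~ tpath G x & z = reg_e K x].

(* J = N + d(N); this is the direct sum of the N^n + d(N^(n-1)) *)
Definition J_set : set R :=
  [set z | exists x y, [/\ nonpath_span x, nonpath_span y & z = x + reg_d y]].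

Let HN : submodule nonpath_span := span_submodule _.

Lemma nonpath_span_mul a x : nonpath_span x ->
  nonpath_span (a ** x) /\ nonpath_span (x ** a).
Proof.
move: x; apply: span_ind => [|_ [q /andP[rq nq] ->]].
  split=> [|b u v /= [Hu1 Hu2] [Hv1 Hv2]].
    by rewrite amul0x amulx0; split; apply: (submod0 HN).
  by rewrite amulPl amulPr; split; apply: HN.2.
move: a; apply: reg_ind => [|p rp].
  split=> [|b u v /= [Hu1 Hu2] [Hv1 Hv2]].
    by rewrite amul0x amulx0; split; apply: (submod0 HN).
  by rewrite amulPl amulPr; split; apply: HN.2.
rewrite !reg_eM //.
have rpE := rp; rewrite /regular in rpE; have rqE := rq; rewrite /regular in rqE.
split; case: eqP => [pq|_]; try exact: (submod0 HN); apply: span_gen.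
  exists (tconcat p q) => //.
  by rewrite /regular !tpath_cat // rpE rqE negb_and nq orbT.
exists (tconcat q p) => //.
by rewrite /regular !tpath_cat // rpE rqE negb_and nq.
Qed.

Lemma J_submodule : submodule J_set.
Proof.
split=> [|a _ _ [x1 [y1 [Nx1 Ny1 ->]]] [x2 [y2 [Nx2 Ny2 ->]]]].
  exists 0, 0; split; [exact: (submod0 HN) | exact: (submod0 HN) |].
  by rewrite reg_d0 addr0.
exists (a *: x1 + x2), (a *: y1 + y2); split; [exact: HN.2 | exact: HN.2 |].
by rewrite reg_d_linear scalerDr addrACA.
Qed.

Lemma J_nonpath x : nonpath_span x -> J_set x.
Proof.
move=> Nx; exists x, 0; split=> //; first exact: (submod0 HN).
by rewrite reg_d0 addr0.
Qed.

Lemma J_d_nonpath x : nonpath_span x -> J_set (reg_d x).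
Proof.
move=> Nx; exists 0, x; split=> //; first exact: (submod0 HN).
by rewrite add0r.
Qed.

Lemma J_two_sided_ideal : two_sided_ideal J_set.
Proof.
have HJ := J_submodule.
split=> // a _ [x [y [Nx Ny ->]]].
have [axN xaN] := nonpath_span_mul a Nx.
rewrite amulDr amulDl; split; apply: (submodD HJ);
  try exact: J_nonpath; clear x Nx axN xaN.
  move: a; apply: reg_ind => [|p rp].
    split=> [|b u v /= Hu Hv]; first by rewrite amul0x; apply: (submod0 HJ).
    by rewrite amulPl; apply: HJ.2.
  have -> : reg_e K p ** reg_d y = (-1) ^+ (tlength p) *:
      (reg_d (reg_e K p ** y) - reg_d (reg_e K p) ** y).
    by rewrite reg_leibniz_e // addrC addKr scalerA -expr2 sqrr_sign scale1r.
  apply: (submodZ _ HJ); apply: (submodB HJ).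
    by apply: J_d_nonpath; case: (nonpath_span_mul (reg_e K p) Ny).
  by apply: J_nonpath; case: (nonpath_span_mul (reg_d (reg_e K p)) Ny).
move: y Ny; apply: span_ind => [|_ [q /andP[rq nq] ->]].
  split=> [|b u v /= Hu Hv]; first by rewrite reg_d0 amul0x; apply: (submod0 HJ).
  by rewrite reg_d_linear amulPl; apply: HJ.2.
have Nq : nonpath_span (reg_e K q).
  by apply: span_gen; exists q => //; apply/andP.
have -> : reg_d (reg_e K q) ** a = reg_d (reg_e K q ** a)
    - (-1) ^+ (tlength q) *: (reg_e K q ** reg_d a).
  by rewrite reg_leibniz_e // addrK.
apply: (submodB HJ).
  by apply: J_d_nonpath; case: (nonpath_span_mul a Nq).
apply: (submodZ _ HJ); apply: J_nonpath.
by case: (nonpath_span_mul (reg_d a) Nq).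
Qed.

Definition J_ideal : ideal R := Ideal J_two_sided_ideal.

Lemma J_d x : J_set x -> J_set (reg_d x).
Proof.
move=> [u [v [Nu Nv ->]]]; rewrite reg_dD reg_dd addr0; exact: J_d_nonpath.
Qed.

Definition Omega_alg : assocAlgType K := quotient_alg J_ideal.

Definition Omega_d (x : Omega_alg) : Omega_alg :=
  qproj J_ideal (reg_d (qrepr x)).

Definition Omega_gr (n : nat) : set Omega_alg :=
  qproj J_ideal @` @reg_gr K V n.

Lemma Omega_d_qproj x : Omega_d (qproj J_ideal x) = qproj J_ideal (reg_d x).
Proof.
apply/qproj_eq; rewrite -scaleN1r addrC -reg_d_linear addrC scaleN1r.
by apply: J_d; exact: (@qprojK _ _ J_ideal).
Qed.

End PathCochainAlgebra.

Section OmegaDG.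
Variables (K : comPzRingType) (V : finType) (G : digraph V).
Local Notation R := (reg_complex K V).
Local Notation J := (J_ideal K G).
Local Notation reg_e := (reg_e K).

Let homog (n : nat) : Lambda K V -> Lambda K V :=
  linext (fun x : epath (full_rel V) =>
    if tlength (val x) == n then lam_e K (val x) else 0).

Let homogP n (a : K) x y : homog n (a *: x + y) = a *: homog n x + homog n y.
Proof. exact: linext_linear. Qed.
Let homog0 n : homog n 0 = 0. Proof. exact: linext0. Qed.
Let homogZ n (a : K) x : homog n (a *: x) = a *: homog n x.
Proof. exact: linextZ. Qed.
Let homog_sum n (I : Type) (r : seq I) (P : pred I) (g : I -> Lambda K V) :
  homog n (\sum_(i <- r | P i) g i) = \sum_(i <- r | P i) homog n (g i).
Proof. exact: linext_sum. Qed.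

Let homog_e n p : homog n (lam_e K p) = if tlength p == n then lam_e K p else 0.
Proof.
rewrite /lam_e; have xf := tpath_full p.
rewrite -[in LHS](SubK (epath (full_rel V) : subType _) xf) tbasis_val.
by rewrite /homog linext_basis /lam_e -tbasis_val SubK.
Qed.

Let homog_d n x : homog n (lam_d x) =
  if n is m.+1 then lam_d (homog m x) else 0.
Proof.
move: x; apply: lam_ind => [|p].
  split=> [|a u v /= Hu Hv].
    by rewrite lam_d0 homog0; case: n => // n; rewrite homog0 lam_d0.
  rewrite lam_d_linear homogP Hu Hv; case: n {Hu Hv} => [|n].
    by rewrite scaler0 addr0.
  by rewrite homogP lam_d_linear.
have E : homog n (lam_d (lam_e K p)) =
    if (tlength p).+1 == n then lam_d (lam_e K p) else 0.
  rewrite lam_d_e homog_sum; case: ifP => En.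
    apply: eq_bigr => i _; rewrite homog_sum; apply: eq_bigr => v _.
    by rewrite homogZ homog_e tlength_insert ?En // -ltnS.
  apply: big1 => i _; rewrite homog_sum; apply: big1 => v _.
  by rewrite homogZ homog_e tlength_insert ?En ?scaler0 // -ltnS.
rewrite E; case: n {E} => // n; rewrite eqSS homog_e.
by case: ifP => // _; rewrite lam_d0.
Qed.

Let homog_gr n (z : R) : reg_gr n z ->
  forall m, homog m (val z) = if n == m then val z else 0.
Proof.
move: z; apply: span_ind => [|_ [p /andP[rp /eqP pn] ->] m].
  split=> [|a u v Hu Hv] m; first by rewrite val_reg0 homog0 if_same.
  by rewrite val_regP homogP Hu Hv; case: ifP => // _; rewrite scaler0 addr0.
by rewrite val_reg_e // homog_e pn.
Qed.

Let homog_reg n (z : R) : exists2 w : R, reg_gr n w & val w = homog n (val z).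
Proof.
have HS : submodule (@reg_gr K V n) by apply: span_submodule.
move: z; apply: reg_ind => [|p rp].
  split=> [|a u v [u' Hu Eu] [v' Hv Ev]].
    by exists 0; [apply: (submod0 HS) | rewrite val_reg0 homog0].
  by exists (a *: u' + v'); [apply: HS.2 | rewrite !val_regP homogP Eu Ev].
rewrite val_reg_e // homog_e; case: ifP => pn.
  exists (reg_e p); last exact: val_reg_e.
  by apply: span_gen; exists p => //; rewrite rp pn.
by exists 0 => //; apply: (submod0 HS).
Qed.

Let homog_nonpath n (z : R) : nonpath_span G z ->
  exists2 w : R, nonpath_span G w & val w = homog n (val z).
Proof.
have HS : submodule (@nonpath_span K V G) by apply: span_submodule.
move: z; apply: span_ind => [|_ [p rp ->]].
  split=> [|a u v [u' Hu Eu] [v' Hv Ev]].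
    by exists 0; [apply: (submod0 HS) | rewrite val_reg0 homog0].
  by exists (a *: u' + v'); [apply: HS.2 | rewrite !val_regP homogP Eu Ev].
have [rp1 rp2] := andP rp.
rewrite val_reg_e // homog_e; case: ifP => pn.
  exists (reg_e p); last exact: val_reg_e.
  by apply: span_gen; exists p.
by exists 0 => //; apply: (submod0 HS).
Qed.

Let homog_J n (z : R) : J z -> exists2 w : R, J w & val w = homog n (val z).
Proof.
move=> [x [y [Nx Ny ->]]].
have [x' Nx' Ex'] := homog_nonpath n Nx.
have -> : val (x + reg_d y) = 1 *: val x + lam_d (val y) by rewrite scale1r.
rewrite homogP homog_d scale1r -Ex'.
case: n {Ex'} => [|n].
  by exists x'; [apply: J_nonpath | rewrite addr0].
have [y' Ny' Ey'] := homog_nonpath n Ny.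
by exists (x' + reg_d y'); [exists x', y' | rewrite -Ey'].
Qed.

Let reg_gr_d n (x : R) : reg_gr n x -> reg_gr n.+1 (reg_d x).
Proof.
move=> Hx; have [w Hw Ew] := homog_reg n.+1 (reg_d x).
suff -> : reg_d x = w by [].
by apply: val_inj; rewrite Ew val_reg_d homog_d (homog_gr Hx) eqxx.
Qed.

Let reg_gr_submodule n : submodule (@reg_gr K V n) := span_submodule _.

Let reg_gr_total (x : R) : exists n (c : nat -> R),
  [/\ forall i, reg_gr i (c i), forall i, (n <= i)%N -> c i = 0
    & x = \sum_(i < n) c i].
Proof.
have ext n m (c : nat -> R) : (n <= m)%N -> (forall i, (n <= i)%N -> c i = 0) ->
    \sum_(i < n) c i = \sum_(i < m) c i.
  move=> nm c0; rewrite (big_ord_widen m (fun i => c i) nm) big_mkcond /=.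
  by apply: eq_bigr => i _; case: ltnP => // /c0 ->.
move: x; apply: reg_ind => [|p rp].
  split=> [|a u v /= [n [c [Hc c0 ->]]] [m [d [Hd d0 ->]]]].
    exists 0%N, (fun=> 0); split=> [i|//|]; first exact: submod0.
    by rewrite big_ord0.
  exists (maxn n m), (fun i => a *: c i + d i); split=> [i|i|].
  - exact: (reg_gr_submodule i).2.
  - by rewrite geq_max => /andP[ni mi]; rewrite c0 // d0 // scaler0 addr0.
  - rewrite (ext n (maxn n m)) ?leq_maxl // (ext m (maxn n m)) ?leq_maxr //.
    by rewrite scaler_sumr -big_split.
exists (tlength p).+1, (fun i => if i == tlength p then reg_e p else 0).
split=> [i|i|].
- case: eqP => [->|_]; last exact: submod0.
  by apply: span_gen; exists p => //; rewrite rp eqxx.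
- by move=> pi; case: eqP pi => // ->; rewrite ltnn.
- rewrite big_ord_recr /= eqxx big1 ?add0r // => i _.
  by rewrite ltn_eqF.
Qed.

Let reg_grM m n (x y : R) : reg_gr m x -> reg_gr n y ->
  reg_gr (m + n)%N (x ** y).
Proof.
have HS := reg_gr_submodule (m + n)%N.
move=> Hx Hy; move: x Hx; apply: span_ind => [|_ [p /andP[rp /eqP pm] ->]].
  split=> [|a u v /= Hu Hv]; first by rewrite amul0x; apply: (submod0 HS).
  by rewrite amulPl; apply: HS.2.
move: y Hy; apply: span_ind => [|_ [q /andP[rq /eqP qn] ->]].
  split=> [|a u v /= Hu Hv]; first by rewrite amulx0; apply: (submod0 HS).
  by rewrite amulPr; apply: HS.2.
rewrite reg_eM //; case: eqP => [pq|_]; last exact: (submod0 HS).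
apply: span_gen; exists (tconcat p q) => //.
by rewrite tlength_cat pm qn eqxx andbT /regular tpath_cat //; apply/andP.
Qed.

Let reg_gr1 : reg_gr 0 (aone R).
Proof.
have -> : aone R = \sum_(v : V) reg_e (v, [::]).
  apply: val_inj; rewrite [LHS](tuple_algebra_oneE K (full_rel V)).
  rewrite (big_morph val (id1 := 0) (op1 := +%R)) //.
  by apply: eq_bigr => v _; rewrite val_reg_e.
apply: (submod_sum _ (reg_gr_submodule 0)) => v _.
by apply: span_gen; exists (v, [::]).
Qed.

Let reg_leibniz n (x y : R) : reg_gr n x ->
  reg_d (x ** y) = reg_d x ** y + (-1) ^+ n *: (x ** reg_d y).
Proof.
move: x; apply: span_ind => [|_ [p /andP[rp /eqP <-] ->]].
  split=> [|a u v /= Hu Hv].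
    by rewrite reg_d0 !amul0x reg_d0 scaler0 addr0.
  rewrite !(amulPl, reg_d_linear) Hu Hv !scalerDr !scalerA.
  by rewrite [(_ ^+ _) * a]mulrC addrACA.
exact: reg_leibniz_e.
Qed.

Lemma Omega_is_dg : is_dg_algebra (@Omega_gr K V G) (@Omega_d K V G).
Proof.
split.
- move=> n; split; first by exists 0; [apply: submod0 | rewrite qproj0].
  move=> a _ _ [u Hu <-] [v Hv <-]; exists (a *: u + v).
    exact: (reg_gr_submodule n).2.
  by rewrite qprojD qprojZ.
- move=> x; have [n [c [Hc _ Ec]]] := reg_gr_total (qrepr x).
  exists n, (fun i => qproj J (c i)); split=> [i|]; first by exists (c i).
  by rewrite -[x]qreprK Ec qproj_sum.
- move=> n c Hc c0 i ni.
  have /choice[r Hr] : forall i, exists r, reg_gr i r /\ qproj J r = c i.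
    by move=> j; have [r Hr Er] := Hc j; exists r.
  have Jr : J (\sum_(i < n) r i).
    apply/qproj_eq0; rewrite qproj_sum -[RHS]c0.
    by apply: eq_bigr => j _; case: (Hr j).
  have [w Jw Ew] := homog_J i Jr.
  have [_ <-] := Hr i; apply/qproj_eq0; suff -> : r i = w by [].
  apply: val_inj; rewrite Ew (big_morph val (id1 := 0) (op1 := +%R)) //.
  rewrite homog_sum (bigD1 (Ordinal ni)) //= big1 ?addr0 => [|j ji].
    by rewrite (homog_gr (Hr i).1) eqxx.
  rewrite (homog_gr (Hr j).1) ifN //.
- by exists (aone R).
- move=> m n _ _ [x Hx <-] [y Hy <-]; exists (x ** y); first exact: reg_grM.
  by rewrite qprojM.
- move=> a x y; rewrite -[x]qreprK -[y]qreprK -qprojZ -qprojD !Omega_d_qproj.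
  by rewrite reg_d_linear qprojD qprojZ.
- move=> n _ [x Hx <-]; rewrite Omega_d_qproj.
  by exists (reg_d x) => //; apply: reg_gr_d.
- by move=> x; rewrite -[x]qreprK !Omega_d_qproj reg_dd qproj0.
- move=> n _ y [x Hx <-]; rewrite -[y]qreprK -qprojM !Omega_d_qproj.
  by rewrite (reg_leibniz _ Hx) qprojD qprojZ !qprojM.
Qed.

End OmegaDG.

Definition Omega (K : comPzRingType) (V : finType) (G : digraph V) :
  dgAlgebra K := DGAlgebra (Omega_is_dg K G).

Section PathAlgebraQuotient.
Variables (K : comPzRingType) (V : finType) (G : digraph V).

Definition path_algebra : assocAlgType K := tuple_algebra K G.

(* the path p as an element of KG (and 0 if p is not a path of G) *)
Definition gpath (p : vtuple V) : path_algebra := tbasis K G p.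

Definition has_path (x y : V) (n : nat) : bool :=
  [exists s : n.-tuple V, path G x s && (last x s == y)].

(* None stands for an infinite distance *)
Definition dist (x y : V) : option nat :=
  if pselect (exists n, has_path x y n) is left ex then Some (ex_minn ex)
  else None.

Definition t_rel (x y : V) : path_algebra :=
  \sum_(v : V | tpath G (x, [:: v; y])) gpath (x, [:: v; y]).

Definition T_ideal : ideal path_algebra :=
  ideal_gen [set z | exists x y, dist x y = Some 2%N /\ z = t_rel x y].

Definition KGT : assocAlgType K := quotient_alg T_ideal.

Definition KGT_gr (n : nat) : set KGT :=
  qproj T_ideal @`
    span [set z | exists2 p, tpath G p && (tlength p == n) & z = gpath p].

End PathAlgebraQuotient.

(* Main.v *)
Require Import Defs.
From HB Require Import structures.
From mathcomp Require Import all_boot all_order all_algebra.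
From mathcomp Require Import boolp classical_sets.

Set Implicit Arguments.
Unset Strict Implicit.
Unset Printing Implicit Defensive.

Import GRing.Theory.

Local Open Scope ring_scope.

(** Killing the tuples that are not paths is a surjection from the tuple
    algebra onto $\mathbb{K}G$; it is multiplicative ([path_projM]) because a
    concatenation of tuples is a path exactly when both factors are. Restricted
    to $\mathcal{R}$ it has kernel $\mathcal{N}$, so that
    $\mathcal{R}/\mathcal{N}$ is $\mathbb{K}G$, and it remains to see that the
    image of $\partial(\mathcal{N})$ is the ideal $T$.

    The link is the missing arrow: if $x\neq y$ and $(x,y)$ is not an arrow,
    then the only paths obtained by inserting a vertex in $(x,y)$ are the
    $(x,v,y)$, inserted with sign $-1$; hence $\partial(e^{x,y})$ is sent to
    $-t_{x,y}$ ([path_proj_d_nonarrow]). This is, up to sign, a generator of $T$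
    if $d(x,y)=2$, and otherwise an empty sum ([T_ideal_t_rel]). A regular tuple
    that is not a path factors as $e^a e^{x,y} e^b$ with $(x,y)$ a missing arrow;
    since $e^{x,y}$ itself is killed, the Leibniz rule leaves only
    $\pm e^a\,\partial(e^{x,y})\,e^b$, which lands in $T$
    ([path_proj_d_nonpath]).

    Therefore the projection induces a map from $\Omega$ to $\mathbb{K}G/T$.
    Its inverse sends a path to its class in $\Omega$: this is multiplicative
    ([path_classM]) and kills $t_{x,y}$, whose class is that of
    $-\partial(e^{x,y})$ ([path_class_T]). The dg structure of $\Omega$ is then
    carried to $\mathbb{K}G/T$ along this bijection ([transport_is_dg]), and the
    formula for the differential is that of $\mathcal{R}$ with the non-paths
    dropped ([path_proj_d_e]). *)

(** * Transport of dg structures *)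

Section Transport.
Variables (K : comPzRingType) (A : dgAlgebra K) (B : assocAlgType K).
Variables (gr : nat -> set B) (f : A -> B) (g : B -> A).
Hypothesis fK : cancel f g.
Hypothesis gK : cancel g f.
Hypothesis f_linear : forall (a : K) x y, f (a *: x + y) = a *: f x + f y.
Hypothesis f_one : f (aone A) = aone B.
Hypothesis f_mul : forall x y, f (x ** y) = f x ** f y.
Hypothesis f_gr : forall n x, dg_gr n x -> gr n (f x).
Hypothesis g_gr : forall n y, gr n y -> dg_gr n (g y).

(** Conjugating the differential of [A] makes [f] commute with the differentials
    by construction, and each axiom for it reduces to the same axiom in [A]. *)
Definition transported_d (y : B) : B := f (dg_d (g y)).

Lemma transport_is_dg : is_dg_algebra gr transported_d.
Proof.
have dgA := dg_axioms A.
have f0 : f 0 = 0.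
  by have := f_linear (-1) 0 0; rewrite scaler0 addr0 scaleN1r addNr.
have fD x y : f (x + y) = f x + f y.
  by rewrite -[x in LHS]scale1r f_linear scale1r.
have f_sum n (c : nat -> A) : f (\sum_(i < n) c i) = \sum_(i < n) f (c i).
  exact: (big_morph f fD f0).
have g_linear (a : K) x y : g (a *: x + y) = a *: g x + g y.
  by apply: (can_inj fK); rewrite f_linear !gK.
have g_mul x y : g (x ** y) = g x ** g y.
  by apply: (can_inj fK); rewrite f_mul !gK.
split.
- move=> n; have [S0 SL] := dg_gr_submodule dgA n.
  split=> [|a u v Bu Bv]; first by rewrite -f0; apply: f_gr.
  by rewrite -[_ + _]gK g_linear; apply/f_gr/SL; apply: g_gr.
- move=> y; have [n [c [Hc Ec]]] := dg_gr_total dgA (g y).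
  exists n, (f \o c); split=> [i|]; first exact/f_gr/Hc.
  by rewrite -[y]gK Ec [LHS](f_sum n c).
- move=> n c Hc c0 i ni; rewrite -[c i]gK -f0; congr f.
  apply: (dg_gr_direct dgA (c := g \o c) (n := n)) => //= [j|].
    exact/g_gr/Hc.
  apply: (can_inj fK); rewrite [LHS](f_sum n (g \o c)) f0 -[RHS]c0.
  by apply: eq_bigr => j _ /=; rewrite gK.
- by rewrite -f_one; apply/f_gr/(dg_gr1 dgA).
- move=> m n x y Hx Hy; rewrite -[_ ** _]gK g_mul.
  by apply/f_gr/(dg_grM dgA); apply: g_gr.
- by move=> a x y; rewrite /transported_d g_linear (dg_d_linear dgA) f_linear.
- by move=> n x Hx; apply/f_gr/(dg_d_gr dgA)/g_gr.
- by move=> x; rewrite /transported_d fK (dg_dd dgA).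
- move=> n x y Hx; rewrite /transported_d g_mul.
  by rewrite (dg_leibniz dgA _ (g_gr Hx)) addrC f_linear !f_mul !gK addrC.
Qed.

Lemma transport_isomorphism (d_dg : is_dg_algebra gr transported_d) :
  @dg_isomorphism K A (DGAlgebra d_dg) f.
Proof.
split=> //; first by exists g.
by move=> x; rewrite /= /transported_d fK.
Qed.

End Transport.

Section PathAlgebraPresentation.
Local Open Scope classical_set_scope.
Variables (K : comPzRingType) (V : finType) (G : digraph V).
Local Notation R := (reg_complex K V).
Local Notation KG := (path_algebra K G).
Local Notation gpath := (gpath K G).
Local Notation lam_e := (lam_e K).
Local Notation reg_e := (reg_e K).
Local Notation J := (J_ideal K G).
Local Notation T := (T_ideal K G).

(** * Projection of tuples onto paths *)

Lemma gpath_out p : ~~ tpath G p -> gpath p = 0.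
Proof. exact: tbasis_out. Qed.

Definition path_proj : Lambda K V -> KG :=
  linext (fun x : epath (full_rel V) => gpath (val x)).

Lemma path_proj_linear (a : K) x y :
  path_proj (a *: x + y) = a *: path_proj x + path_proj y.
Proof. exact: linext_linear. Qed.

Lemma path_proj0 : path_proj 0 = 0. Proof. exact: linext0. Qed.

Lemma path_projD x y : path_proj (x + y) = path_proj x + path_proj y.
Proof. exact: linextD. Qed.

Lemma path_projZ (a : K) x : path_proj (a *: x) = a *: path_proj x.
Proof. exact: linextZ. Qed.

Lemma path_proj_sum (I : Type) (r : seq I) (P : pred I) (F : I -> Lambda K V) :
  path_proj (\sum_(i <- r | P i) F i) = \sum_(i <- r | P i) path_proj (F i).
Proof. exact: linext_sum. Qed.

Lemma path_proj_e p : path_proj (lam_e p) = gpath p.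
Proof.
rewrite /Defs.lam_e -[in LHS](SubK (epath (full_rel V) : subType _) (tpath_full p)).
by rewrite tbasis_val /path_proj linext_basis SubK.
Qed.

(** A concatenation is a path if and only if its factors are, so killing the
    non-paths before or after multiplying gives the same result. *)
Lemma path_projM x y : path_proj (x ** y) = path_proj x ** path_proj y.
Proof.
move: x; apply: lam_ind => [|p].
  split=> [|a u v /= Hu Hv]; first by rewrite amul0x path_proj0 amul0x.
  by rewrite amulPl !path_proj_linear amulPl Hu Hv.
move: y; apply: lam_ind => [|q].
  split=> [|a u v /= Hu Hv]; first by rewrite amulx0 path_proj0 amulx0.
  by rewrite amulPr !path_proj_linear amulPr Hu Hv.
rewrite lam_eM !path_proj_e.
have [pG|pnG] := boolP (tpath G p); last first.
  rewrite [gpath p]gpath_out // amul0x; case: eqP => [pq|_].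
    by rewrite path_proj_e gpath_out // tpath_cat // (negbTE pnG).
  exact: path_proj0.
have [qG|qnG] := boolP (tpath G q); last first.
  rewrite [gpath q]gpath_out // amulx0; case: eqP => [pq|_].
    by rewrite path_proj_e gpath_out // tpath_cat // (negbTE qnG) andbF.
  exact: path_proj0.
rewrite [RHS]tbasisM //; case: eqP => _; first exact: path_proj_e.
exact: path_proj0.
Qed.

Lemma path_proj1 : path_proj (aone (Lambda K V)) = aone KG.
Proof.
rewrite !tuple_algebra_oneE path_proj_sum.
by apply: eq_bigr => v _; rewrite path_proj_e.
Qed.

Lemma path_proj_d_e p : path_proj (lam_d (lam_e p)) =
  \sum_(i < (tlength p).+2) \sum_(v : V | tpath G (tinsert i v p))
    (-1) ^+ i *: gpath (tinsert i v p).
Proof.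
rewrite lam_d_e path_proj_sum; apply: eq_bigr => i _.
rewrite path_proj_sum [RHS]big_mkcond; apply: eq_bigr => v _.
rewrite path_projZ path_proj_e; case: ifPn => // np.
by rewrite gpath_out // scaler0.
Qed.

Lemma tpath_regular p : tpath G p -> regular p.
Proof.
case: p => x s; apply: sub_path => u v; apply: contraTneq => ->.
by rewrite arrow_irr.
Qed.

(** * The differential of a missing arrow *)

(** Inserting a vertex at either end of [(x, y)] keeps [x] and [y] consecutive,
    which no path allows; only the middle position, of sign [-1], survives. *)
Lemma path_proj_d_nonarrow x y : ~~ G x y ->
  path_proj (lam_d (lam_e (x, [:: y]))) = - t_rel K G x y.
Proof.
move=> xy; rewrite path_proj_d_e !big_ord_recl big_ord0 /=.
rewrite [X in X + _]big_pred0 => [|v]; last first.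
  by rewrite /tpath /= (negbTE xy) andbF.
rewrite [X in _ + (_ + (X + _))]big_pred0 => [|v]; last first.
  by rewrite /tpath /= (negbTE xy).
rewrite add0r !addr0 -sumrN.
by apply: eq_bigr => v _; rewrite expr1 scaleN1r.
Qed.

Lemma has_pathP x y n :
  reflect (exists s : seq V, [/\ size s = n, path G x s & last x s = y])
          (has_path G x y n).
Proof.
apply: (iffP existsP) => [[s /andP[ps /eqP ls]]|[s [/eqP sn ps ls]]].
  by exists s; rewrite size_tuple.
by exists (Tuple sn); rewrite /= ps ls eqxx.
Qed.

Lemma dist2P x y : dist G x y = Some 2%N <->
  [/\ x != y, ~~ G x y & exists v, G x v && G v y].
Proof.
rewrite /dist; case: pselect => [ex|nex]; last first.
  split=> // -[_ _ [v /andP[xv vy]]]; case: nex; exists 2%N.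
  by apply/has_pathP; exists [:: v; y]; rewrite /= xv vy.
case: ex_minnP => n /has_pathP[s [sn ps ls]] nmin; split=> [[n2]|].
  rewrite {}n2 in sn nmin; split.
  - apply/negP => /eqP xy; suff: (2 <= 0)%N by [].
    by apply/nmin/has_pathP; exists [::].
  - apply/negP => xy; suff: (2 <= 1)%N by [].
    by apply/nmin/has_pathP; exists [:: y]; rewrite /= xy.
  - case: s sn ps ls => [|v [|w []]] //= _ /and3P[xv vw _] <-.
    by exists v; rewrite xv.
move=> [xy nxy [v /andP[xv vy]]]; congr Some; apply/eqP; rewrite eqn_leq.
rewrite nmin /=; last by apply/has_pathP; exists [:: v; y]; rewrite /= xv vy.
case: s sn ps ls => [|w [|w' s]] /= <- //.
  by move=> _ /eqP; rewrite (negbTE xy).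
by rewrite andbT => xw wy; rewrite -wy xw in nxy.
Qed.

(** If there is a middle vertex, then [x] and [y] are at distance 2 and this is
    a generator; if there is none, the sum is empty. *)
Lemma T_ideal_t_rel x y : x != y -> ~~ G x y -> T (t_rel K G x y).
Proof.
move=> xy nxy; have [/existsP[v xvy]|nv] := boolP [exists v, G x v && G v y].
  apply: sub_gen_smallest; exists x, y; split=> //.
  by apply/dist2P; split=> //; exists v.
rewrite /t_rel big_pred0 => [|v]; first exact: (submod0 (idealP T).1).
apply: contraNF nv; rewrite /tpath /= andbT => xvy.
by apply/existsP; exists v.
Qed.

(** * The two ideals correspond *)

(** Split off the first edge of the tuple. If it is an arrow, the rest is not a
    path and the Leibniz rule leaves one term, in [T] by induction; if it is not,
    the Leibniz rule leaves the differential of this missing arrow times the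
    rest. *)
Lemma path_proj_d_nonpath p : regular p -> ~~ tpath G p ->
  T (path_proj (lam_d (lam_e p))).
Proof.
have [HT Tmul] := idealP T.
case: p => x s; elim: s x => // y s IH x /andP[xy rys] np.
have -> : lam_e (x, y :: s) = lam_e (x, [:: y]) ** lam_e (y, s).
  by rewrite lam_eM eqxx.
rewrite lam_leibniz_e path_projD path_projZ !path_projM !path_proj_e.
have [Gxy|nGxy] := boolP (G x y).
  have nys : ~~ tpath G (y, s) by apply: contra np; rewrite /tpath /= Gxy.
  rewrite [gpath (y, s)]gpath_out // amulx0 add0r.
  by apply: (submodZ _ HT); apply: (Tmul _ _ (IH y rys nys)).1.
rewrite [gpath (x, _)]gpath_out ?amul0x ?scaler0 ?addr0; last first.
  by rewrite /tpath /= (negbTE nGxy).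
apply: (Tmul _ _ _).2; rewrite path_proj_d_nonarrow //.
by apply: (submodN HT); apply: T_ideal_t_rel.
Qed.

Lemma path_proj_J (z : R) : J z -> T (path_proj (val z)).
Proof.
have [HT _] := idealP T.
move=> [x [y [Nx Ny ->]]].
have -> : val (x + reg_d y) = val x + lam_d (val y) by [].
rewrite path_projD; apply: (submodD HT).
  move: x Nx; apply: span_ind => [|_ [p /andP[rp np] ->]].
    split=> [|a u v /= Hu Hv]; first by rewrite path_proj0; apply: submod0.
    by rewrite path_proj_linear; apply: HT.2.
  by rewrite val_reg_e // path_proj_e gpath_out //; apply: submod0.
move: y Ny; apply: span_ind => [|_ [p /andP[rp np] ->]].
  split=> [|a u v /= Hu Hv].
    by rewrite lam_d0 path_proj0; apply: submod0.
  by rewrite lam_d_linear path_proj_linear; apply: HT.2.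
by rewrite val_reg_e //; apply: path_proj_d_nonpath.
Qed.

(** The inverse isomorphism, before it is factored through [T]. *)
Definition path_class : KG -> Omega_alg K G :=
  linext (fun p : epath G => qproj J (reg_e (val p))).

Lemma path_class_linear (a : K) x y :
  path_class (a *: x + y) = a *: path_class x + path_class y.
Proof. exact: linext_linear. Qed.

Lemma path_class0 : path_class 0 = 0. Proof. exact: linext0. Qed.

Lemma path_class_gpath p : tpath G p -> path_class (gpath p) = qproj J (reg_e p).
Proof.
move=> pG; rewrite -[p](SubK (epath G : subType _) pG).
by rewrite [Defs.gpath _ _ _]tbasis_val /path_class linext_basis.
Qed.

(** Dropping the non-paths of [z] changes it by an element of
    $\mathcal{N}\subseteq\mathcal{J}$. As the projection is onto, this
    determines [path_class], and transfers to it the multiplicativity of the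
    projection and of the quotient map. *)
Lemma path_class_proj (z : R) : path_class (path_proj (val z)) = qproj J z.
Proof.
move: z; apply: reg_ind => [|p rp].
  split=> [|a u v /= Hu Hv]; first by rewrite path_proj0 path_class0 qproj0.
  by rewrite path_proj_linear path_class_linear Hu Hv qprojD qprojZ.
rewrite val_reg_e // path_proj_e.
have [pG|np] := boolP (tpath G p); first exact: path_class_gpath.
rewrite gpath_out // path_class0; symmetry; apply/qproj_eq0.
by apply: J_nonpath; apply: span_gen; exists p => //; rewrite rp.
Qed.

Lemma path_proj_surj (x : KG) : exists z : R, path_proj (val z) = x.
Proof.
move: x; apply: tuple_algebra_ind => [|p pG].
  split=> [|a u v /= [z <-] [w <-]]; first by exists 0; rewrite val_reg0 path_proj0.
  by exists (a *: z + w); rewrite val_regP path_proj_linear.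
by exists (reg_e p); rewrite val_reg_e ?path_proj_e //; apply: tpath_regular.
Qed.

Lemma path_classM x y : path_class (x ** y) = path_class x ** path_class y.
Proof.
have [z <-] := path_proj_surj x; have [w <-] := path_proj_surj y.
by rewrite -path_projM -val_regM !path_class_proj qprojM.
Qed.

(** On a generator, $t_{x,y}$ is the projection of $-\partial(e^{x,y})$ with
    $e^{x,y}\in\mathcal{N}$, so its class in $\Omega$ is that of an element of
    $\partial(\mathcal{N})\subseteq\mathcal{J}$. *)
Lemma path_class_T x : T x -> path_class x = 0.
Proof.
move=> Tx; apply: (smallest_sub (X := [set z | path_class z = 0]) _ _ Tx).
  split; last by move=> a u /= Hu; rewrite !path_classM Hu amulx0 amul0x.
  split=> [|a u v /= Hu Hv]; first exact: path_class0.
  by rewrite path_class_linear Hu Hv scaler0 addr0.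
move=> _ [u [v [/dist2P[uv nuv _] ->]]] /=.
have ruv : regular (u, [:: v]) by rewrite /regular /tpath /= uv.
rewrite -[t_rel _ _ _ _]opprK -path_proj_d_nonarrow // -val_reg_e // -val_reg_d.
rewrite -scaleN1r -path_projZ -[_ *: _]/(val (-1 *: reg_d (reg_e (u, [:: v])))).
rewrite path_class_proj qprojZ; suff -> : qproj J (reg_d (reg_e (u, [:: v]))) = 0.
  by rewrite scaler0.
apply/qproj_eq0; apply: J_d_nonpath; apply: span_gen; exists (u, [:: v]) => //.
by rewrite ruv /tpath /= (negbTE nuv).
Qed.

Definition Omega_to_KGT (x : Omega K G) : KGT K G :=
  qproj T (path_proj (val (qrepr x))).

Definition KGT_to_Omega (y : KGT K G) : Omega K G := path_class (qrepr y).

Lemma Omega_to_KGTE (z : R) :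
  Omega_to_KGT (qproj J z) = qproj T (path_proj (val z)).
Proof.
apply/qproj_eq; rewrite addrC -scaleN1r -path_proj_linear addrC scaleN1r.
exact: (path_proj_J (@qprojK _ _ J z)).
Qed.

Lemma KGT_to_OmegaE (x : KG) : KGT_to_Omega (qproj T x) = path_class x.
Proof.
apply/eqP; rewrite -subr_eq0 addrC -scaleN1r -path_class_linear addrC scaleN1r.
by apply/eqP; apply: path_class_T; apply: qprojK.
Qed.

Lemma Omega_to_KGTK : cancel Omega_to_KGT KGT_to_Omega.
Proof. by move=> x; rewrite KGT_to_OmegaE path_class_proj qreprK. Qed.

Lemma KGT_to_OmegaK : cancel KGT_to_Omega Omega_to_KGT.
Proof.
move=> y; rewrite -[y]qreprK; have [z <-] := path_proj_surj (qrepr y).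
by rewrite KGT_to_OmegaE path_class_proj Omega_to_KGTE.
Qed.

Lemma Omega_to_KGT_linear (a : K) x y :
  Omega_to_KGT (a *: x + y) = a *: Omega_to_KGT x + Omega_to_KGT y.
Proof.
rewrite -[x]qreprK -[y]qreprK -qprojZ -qprojD !Omega_to_KGTE val_regP.
by rewrite path_proj_linear qprojD qprojZ.
Qed.

Lemma Omega_to_KGT1 : Omega_to_KGT (aone (Omega K G)) = aone (KGT K G).
Proof. by rewrite -[X in Omega_to_KGT X]qproj1 Omega_to_KGTE path_proj1. Qed.

Lemma Omega_to_KGTM x y :
  Omega_to_KGT (x ** y) = Omega_to_KGT x ** Omega_to_KGT y.
Proof.
rewrite -[x]qreprK -[y]qreprK -qprojM !Omega_to_KGTE val_regM.
by rewrite path_projM qprojM.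
Qed.

Lemma Omega_to_KGT_gr n x : dg_gr n x -> KGT_gr n (Omega_to_KGT x).
Proof.
move=> [z Hz <-]; rewrite Omega_to_KGTE.
exists (path_proj (val z)) => //; move: z Hz; apply: span_ind.
  have HS := span_submodule
    [set z | exists2 p, tpath G p && (tlength p == n) & z = gpath p].
  split=> [|a u v /= Hu Hv]; first by rewrite path_proj0; apply: (submod0 HS).
  by rewrite path_proj_linear; apply: HS.2.
move=> _ [p /andP[rp pn] ->]; rewrite val_reg_e // path_proj_e.
have [pG|np] := boolP (tpath G p).
  by apply: span_gen; exists p => //; rewrite pG.
by rewrite gpath_out //; apply: submod0; apply: span_submodule.
Qed.

Lemma KGT_to_Omega_gr n y : KGT_gr n y -> dg_gr n (KGT_to_Omega y).
Proof.
move=> [x Hx <-]; rewrite KGT_to_OmegaE.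
have HS := dg_gr_submodule (dg_axioms (Omega K G)) n.
move: x Hx; apply: span_ind => [|_ [p /andP[pG pn] ->]].
  split=> [|a u v /= Hu Hv]; first by rewrite path_class0; apply: (submod0 HS).
  by rewrite path_class_linear; apply: HS.2.
rewrite path_class_gpath //; exists (reg_e p) => //.
by apply: span_gen; exists p; rewrite // tpath_regular.
Qed.

End PathAlgebraPresentation.

Theorem theorem5p4 (K : comPzRingType) (V : finType) (G : digraph V) :
  exists (d : KGT K G -> KGT K G) (d_dg : is_dg_algebra (@KGT_gr K V G) d),
    (forall p : vtuple V, tpath G p ->
       d (qproj (T_ideal K G) (gpath K G p)) =
         \sum_(i < (tlength p).+2) \sum_(v : V | tpath G (tinsert i v p))
           (-1) ^+ i *: qproj (T_ideal K G) (gpath K G (tinsert i v p))) /\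
    exists phi : Omega K G -> DGAlgebra d_dg,
      dg_isomorphism phi /\
      (forall p : vtuple V, tpath G p ->
         phi (qproj (J_ideal K G) (reg_e K p)) =
           qproj (T_ideal K G) (gpath K G p)).
Proof.
have d_dg := transport_is_dg (@Omega_to_KGTK K V G) (@KGT_to_OmegaK K V G)
  (@Omega_to_KGT_linear K V G) (@Omega_to_KGT1 K V G) (@Omega_to_KGTM K V G)
  (@Omega_to_KGT_gr K V G) (@KGT_to_Omega_gr K V G).
exists (transported_d (@Omega_to_KGT K V G) (@KGT_to_Omega K V G)), d_dg.
split=> [p pG|].
  rewrite /transported_d KGT_to_OmegaE path_class_gpath //.
  rewrite -[dg_d _]/(Omega_d _) Omega_d_qproj Omega_to_KGTE val_reg_d.
  rewrite val_reg_e ?(tpath_regular pG) // path_proj_d_e qproj_sum.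
  apply: eq_bigr => i _; rewrite qproj_sum.
  by apply: eq_bigr => v _; rewrite qprojZ.
exists (@Omega_to_KGT K V G); split=> [|p pG].
  apply: transport_isomorphism.
  - exact: Omega_to_KGTK.
  - exact: KGT_to_OmegaK.
  - exact: Omega_to_KGT_linear.
  - exact: Omega_to_KGT1.
  - exact: Omega_to_KGTM.
  - exact: Omega_to_KGT_gr.
by rewrite Omega_to_KGTE val_reg_e ?path_proj_e ?(tpath_regular pG).
Qed.
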